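(* For every integer $n\ge 1$, $\mathrm{LPF}_n\subseteq \mathrm{PF}_n$; that is, every Lehmer parking function of length $n$ is a parking function of length $n$.
   Context: Let $[n]=\{1,2,\ldots,n\}$. A tuple $\alpha=(a_1,\ldots,a_n)\in[n]^n$ is a parking function of length $n$ if its weakly increasing rearrangement $(a_1',a_2',\ldots,a_n')$ satisfies $a_i'\le i$ for all $i\in[n]$; $\mathrm{PF}_n$ denotes the set of parking functions of length $n$. A Lehmer parking function of length $n$ is a tuple $(a_1,\ldots,a_n)\in[n]^n$ with $a_i\le n-i+1$ for all $i\in[n]$; $\mathrm{LPF}_n$ denotes the set of Lehmer parking functions of length $n$. *)

(* Defs.v *)
From mathcomp Require Import all_boot.

(* Tuples are indexed from 0 ('I_n), while their entries keep the values
   1, ..., n: the entry a_i of the usual 1-based notation, for i = j + 1, is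
   [tnth a j]. *)

(* The set [n]^n. *)
Definition cube (n : nat) : {pred n.-tuple nat} :=
  [pred a : n.-tuple nat | all (fun x => 1 <= x <= n) a].

(* a'_i <= i, where a' is the weakly increasing rearrangement of a. *)
Definition PF (n : nat) : {pred n.-tuple nat} :=
  [pred a : n.-tuple nat | (a \in cube n) &&
    [forall j : 'I_n, tnth [tuple of sort leq a] j <= j.+1]].

(* a_i <= n - i + 1; the subtraction is exact because i = j + 1 <= n. *)
Definition LPF (n : nat) : {pred n.-tuple nat} :=
  [pred a : n.-tuple nat | (a \in cube n) &&
    [forall j : 'I_n, tnth a j <= n - j.+1 + 1]].

(* Main.v *)
Require Import Defs.
From mathcomp Require Import all_boot.

(** The entry of index [j] of the weakly increasing rearrangement of [a] is at
    most [k] as soon as more than [j] entries of [a] are at most [k]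
    ([nth_sorted_leq]), and that count does not depend on the order of the
    entries.  In a Lehmer parking function the bounds on the last [j.+1]
    entries are [j.+1, ..., 2, 1], so these entries alone are [j.+1] entries
    that are at most [j.+1]. *)

(** If the entry at [j] exceeded [k], so would all later ones, and only the [j]
    entries before it could be at most [k]. *)
Lemma nth_sorted_leq (s : seq nat) (j k : nat) :
  sorted leq s -> j < count (leq^~ k) s -> nth 0 s j <= k.
Proof.
move=> s_sorted j_lt; rewrite leqNgt; apply/negP => k_lt.
have drop0 : count (leq^~ k) (drop j s) = 0.
  apply/eqP; rewrite -leqn0 leqNgt -has_count -all_predC.
  apply/(all_nthP 0) => i; rewrite size_drop ltn_subRL => i_lt /=.
  rewrite nth_drop -ltnNge (leq_trans k_lt) //.
  apply: (sorted_leq_nth leq_trans leqnn) => //; last exact: leq_addr.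
  by rewrite inE (leq_ltn_trans (leq_addr i j)).
move: j_lt; rewrite -(cat_take_drop j s) count_cat drop0 addn0.
by rewrite ltnNge (leq_trans (count_size _ _)) // size_take_min geq_minl.
Qed.

Lemma count_ge_drop (T : Type) (P : pred T) (m : nat) (s : seq T) :
  all P (drop m s) -> size s - m <= count P s.
Proof.
rewrite all_count size_drop => /eqP <-.
by rewrite -{2}(cat_take_drop m s) count_cat leq_addl.
Qed.

Theorem lemma1p1 (n : nat) (hn : 1 <= n) : {subset LPF n <= PF n}.
Proof.
move=> a /andP[a_cube /forallP a_le]; apply/andP; split=> //.
apply/forallP => j; rewrite (tnth_nth 0) /=.
apply: nth_sorted_leq; first exact: (sort_sorted leq_total).
rewrite (permP (permEl (perm_sort leq a))).
have -> : j.+1 = size a - (n - j.+1) by rewrite size_tuple subKn.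
apply: count_ge_drop; apply/(all_nthP 0) => i.
rewrite size_drop size_tuple ltn_subRL nth_drop subKn // => i_lt.
have := a_le (Ordinal i_lt); rewrite (tnth_nth 0) /= => /leq_trans; apply.
by rewrite addn1 subnSK // leq_subCl leq_addr.
Qed.
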